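(* Let $\tau\in\mathbb{Z}$, $m\geq 1$ and $l\geq 0$ be integers. Define $$c_{m,l}(\tau)=-\frac{(-1)^{m\tau+m+l}}{m^2}\binom{m}{l}\binom{m\tau+l-1}{m-1}$$ and $$n_{m,l}(\tau)=\sum_{d\mid m,\ d\mid l}\frac{\mu(d)}{d^2}\,c_{\frac{m}{d},\frac{l}{d}}(\tau),$$ where $\mu$ is the Möbius function and the sum runs over positive integers $d$ dividing both $m$ and $l$ (every $d$ divides $0$). Then $n_{m,l}(\tau)\in\mathbb{Z}$.
   Context: For integers $b\geq 0$ and $a\in\mathbb{Z}$ the binomial coefficient is defined by: $\binom{a}{b}=1$ if $b=0$; $\binom{a}{b}$ is the usual binomial coefficient if $b\geq 1$ and $a\geq 0$ (so it is $0$ when $b>a$); and $\binom{a}{b}=(-1)^b\binom{-a+b-1}{b}$ if $b\geq1$ and $a<0$. (The numbers $n_{m,l}(\tau)$ are the genus-zero LMOV invariants $n_{(m),0,l-m/2}$ of the unknot with framing $\tau$.) *)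

(* Defs.v *)
From mathcomp Require Import all_boot all_order all_algebra.
Set Implicit Arguments. Unset Strict Implicit. Unset Printing Implicit Defensive.
Import Order.TTheory GRing.Theory Num.Theory.
Local Open Scope ring_scope.

Definition binz (a : int) (b : nat) : int :=
  if b == 0%N then 1
  else if (0 <= a) then ('C(absz a, b))%:Z
  else (-1) ^+ b * ('C(absz (- a + b%:Z - 1)%R, b))%:Z.

(* Moebius function on positive integers (mobius 0 = 0 by convention,
   never used). *)
Definition mobius (n : nat) : int :=
  if n == 0%N then 0
  else if all (fun p => (logn p n <= 1)%N) (primes n)
       then (-1) ^+ size (primes n) else 0.

Definition c_ml (tau : int) (m l : nat) : rat :=
  - ((-1) ^ (m%:Z * tau + m%:Z + l%:Z) / (m%:R ^+ 2))
    * ('C(m, l))%:R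
    * (binz (m%:Z * tau + l%:Z - 1) m.-1)%:~R.

Definition n_ml (tau : int) (m l : nat) : rat :=
  \sum_(d <- divisors m | (d %| l)%N)
     ((mobius d)%:~R / (d%:R ^+ 2)) * c_ml tau (m %/ d) (l %/ d).

(* Main.v *)
(** Write [c = f / m^2] with [f(m,l)] an integer; the claim is that [m^2] divides
the sum of [mu(d) f(m/d, l/d)] over [d | g = gcd(m,l)], which is checked one
prime [p] at a time.  The absorption identities show that [(m/g)^2] divides
[f(m,l)], which settles the primes [p] not dividing [g].  If [p | g], the terms
for [d] and [pd] are paired, and it suffices that [f(pm,pl) - f(m,l)] is
divisible by the square of the [p]-part of [pm].  Deleting the multiples of [p]
from the products defining the binomial coefficients shows that
[f(pm,pl) / f(m,l)] is, up to sign, a quotient of products of integers prime to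
[p] over intervals whose length and offset are multiples of the [p]-part [q] of
[gcd(pm,pl)].  Pairing [j] with [q - j], where
[(q y + j) (q y + q - j) = j (q - j)] modulo [q^2], shows that such a product
does not depend on the offset modulo [q^2] (up to sign if [q = 2]).  The missing
factor is supplied by [(m/g)^2 | f(m,l)]. *)
Require Import Defs.
From mathcomp Require Import all_boot all_order all_algebra zify ring.
Import GRing.Theory Num.Theory.
Local Open Scope ring_scope.

(** * Generalized binomial coefficients as falling factorials *)

Lemma binzS (a : int) (b : nat) :
  binz a b.+1 * b.+1%:Z = binz a b * (a - b%:Z).
Proof.
rewrite /binz /=; case: ifPn => [a_ge0 | a_lt0].
  have [n ->] : exists n : nat, a = n by exists `|a|%N; lia.
  have -> : (if b == 0%N then 1 else 'C(`|n|%N, b)%:Z) = 'C(n, b)%:Z.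
    by case: eqP => [->|//]; rewrite bin0.
  rewrite absz_nat -PoszM mulnC mul_bin_left.
  by have [le_bn | lt_nb] := leqP b n; [nia | rewrite bin_small; lia].
have [n ->] : exists n : nat, a = - n.+1%:Z by exists `|a|.-1%N; lia.
set c := (if b == 0 then _ else _).
have -> : c = (-1) ^+ b * 'C(n + b, b)%:Z.
  rewrite /c; case: eqP => [->|_]; first by rewrite bin0.
  by congr (_ * 'C(_, _)%:Z); lia.
have -> : `|(- - n.+1%:Z + b.+1%:Z - 1)%R|%N = (n + b).+1 by lia.
have := mul_bin_diag (n + b).+1 b; rewrite /= exprS => E.
transitivity (- ((-1) ^+ b * ((n + b).+1%:Z * 'C(n + b, b)%:Z))).
  by rewrite -PoszM E PoszM; ring.
have -> : (n + b).+1%:Z = n.+1%:Z + b%:Z by lia.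
by ring.
Qed.

(** Multiplying by the factorial of [b] removes the case split on the sign of [a]: identities for
    [binz] become identities between products. *)
Lemma binz_ffact (a : int) (b : nat) :
  binz a b * b`!%:Z = \prod_(0 <= i < b) (a - i%:Z).
Proof.
elim: b => [|b IHb]; first by rewrite big_geq.
by rewrite big_nat_recr //= -IHb factS PoszM mulrA binzS mulrAC.
Qed.

Lemma binz_nat (n b : nat) : binz n%:Z b = 'C(n, b)%:Z.
Proof. by rewrite /binz; case: eqP => [->|]; rewrite ?bin0. Qed.

Lemma mul_binz_diag (a : int) (b : nat) :
  a * binz (a - 1) b = b.+1%:Z * binz a b.+1.
Proof.
have fact_neq0 : b`!%:Z != 0 by rewrite eqz_nat -lt0n fact_gt0.
apply: (mulIf fact_neq0); rewrite -mulrA binz_ffact.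
have -> : b.+1%:Z * binz a b.+1 * b`!%:Z = binz a b.+1 * (b.+1)`!%:Z.
  by rewrite factS PoszM; ring.
rewrite binz_ffact big_nat_recl //= subr0; congr (_ * _).
by apply: eq_bigr => i _; lia.
Qed.

Lemma binz_pred_fact (x : int) (m : nat) : (0 < m)%N ->
  binz (x - 1) m.-1 * (m.-1)`!%:Z = \prod_(1 <= j < m) (x - m%:Z + j%:Z).
Proof.
case: m => // m _; rewrite binz_ffact big_nat_rev /= big_add1 /=.
by apply: eq_big_nat => i /andP[_ lt_im]; lia.
Qed.

(** * Deleting the multiples of [p] from a product *)

Lemma prodn_mul_dvd (p m : nat) (F : nat -> int) : (0 < p)%N ->
  \prod_(1 <= j < p * m | (p %| j)%N) F j = \prod_(1 <= i < m) F (p * i)%N.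
Proof.
move=> p_gt0; case: m => [|m]; first by rewrite muln0 !big_geq.
elim: m => [|m IHm].
  rewrite muln1 [RHS]big_geq // big_nat_cond big1 // => j.
  by case/andP=> /andP[j_gt0 lt_jp] /(dvdn_leq j_gt0); rewrite leqNgt lt_jp.
rewrite big_nat_recr //= -{}IHm (@big_cat_nat _ _ _ (p * m.+1)) ?leq_mul //=;
  last by rewrite muln_gt0 p_gt0.
congr (_ * _); rewrite big_ltn_cond ?ltn_pmul2l //.
rewrite dvdn_mulr // big_nat_cond big1 ?mulr1 // => j.
case/andP=> /andP[lt_j j_lt] /dvdnP[k def_j]; move: lt_j j_lt.
by rewrite def_j (mulnC k) !ltn_pmul2l //; lia.
Qed.

(** Testing [j] rather than [x + j] keeps the index set independent of the offset; when [p] divides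
    [x], the two tests agree. *)
Definition pfree_prod (p : nat) (x : int) (n : nat) : int :=
  \prod_(0 <= j < n | ~~ (p %| j)%N) (x + j%:Z).

Lemma prod_pfree (p m : nat) (x : int) : (0 < p)%N -> (0 < m)%N ->
  \prod_(1 <= j < p * m) (p%:Z * x + j%:Z) =
  pfree_prod p (p%:Z * x) (p * m) * p%:Z ^+ m.-1
  * \prod_(1 <= j < m) (x + j%:Z).
Proof.
move=> p_gt0 m_gt0; rewrite (bigID (fun j => p %| j)%N) /= prodn_mul_dvd //.
rewrite /pfree_prod [in RHS]big_ltn_cond ?muln_gt0 ?p_gt0 //= dvdn0 /=.
rewrite mulrC -mulrA; congr (_ * _).
under eq_bigr do rewrite PoszM -mulrDr.
by rewrite big_split /= prodr_const_nat subn1.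
Qed.

(** [prod_pfree] applies both to the numerator and to the factorial of [p * m - 1], and the powers
    of [p] that it extracts cancel. *)
Lemma binz_pred_pfree (p m : nat) (x : int) : (0 < p)%N -> (0 < m)%N ->
  binz (p%:Z * x - 1) (p * m).-1 * pfree_prod p 0 (p * m) =
  binz (x - 1) m.-1 * pfree_prod p (p%:Z * (x - m%:Z)) (p * m).
Proof.
move=> p_gt0 m_gt0; have pm_gt0 : (0 < p * m)%N by rewrite muln_gt0 p_gt0.
have factE n : (0 < n)%N -> (n.-1)`!%:Z = \prod_(1 <= j < n) (j%:Z).
  by case: n => // n _; rewrite fact_prod (big_morph Posz PoszM (erefl _)).
have fact_pfree : (p * m).-1`!%:Z =
    pfree_prod p 0 (p * m) * p%:Z ^+ m.-1 * m.-1`!%:Z.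
  rewrite !factE //; have := @prod_pfree p m 0 p_gt0 m_gt0.
  by rewrite mulr0; under eq_bigr do rewrite add0r; under [X in _ * X]eq_bigr do rewrite add0r.
set K := p%:Z ^+ m.-1 * m.-1`!%:Z.
have K_neq0 : K != 0.
  by rewrite mulf_neq0 ?expf_neq0 // eqz_nat -lt0n ?fact_gt0.
apply: (mulIf K_neq0).
have -> : binz (p%:Z * x - 1) (p * m).-1 * pfree_prod p 0 (p * m) * K =
    binz (p%:Z * x - 1) (p * m).-1 * (p * m).-1`!%:Z.
  by rewrite fact_pfree /K; ring.
rewrite binz_pred_fact // PoszM -mulrBr prod_pfree // -binz_pred_fact //.
by rewrite /K; ring.
Qed.

(** * Products of integers prime to [p] modulo the square of a power of [p] *)

Lemma prod_eqz_mod (d : int) (I : Type) (r : seq I) (P : pred I)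
    (F G : I -> int) :
  (forall i, P i -> (F i = G i %[mod d])%Z) ->
  (\prod_(i <- r | P i) F i = \prod_(i <- r | P i) G i %[mod d])%Z.
Proof.
move=> eqFG; apply: (big_ind2 (fun a b => (a = b %[mod d])%Z)) => //.
by move=> a b a' b' eq_ab eq_ab'; rewrite -modzMm eq_ab eq_ab' modzMm.
Qed.

(* The sign relating the products of the units modulo [q] in different blocks;
   only [q = 2] is exceptional, as its unit [1] is its own opposite. *)
Definition block_sign (q : nat) : int := if q == 2%N then -1 else 1.

Lemma block_sign_unit (q : nat) : block_sign q \is a GRing.unit.
Proof. by rewrite /block_sign; case: eqP; rewrite ?unitrN ?unitr1. Qed.

Lemma pfree_prod_fold (p c : nat) (F : nat -> int) :
  prime p -> (0 < c)%N -> (p ^ c)%N != 2%N ->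
  \prod_(0 <= j < (p ^ c)%N | ~~ (p %| j)%N) F j =
  \prod_(1 <= j < (p ^ c)%N | ~~ (p %| j)%N && (2 * j < (p ^ c)%N)%N)
    (F j * F ((p ^ c)%N - j)%N).
Proof.
move=> p_pr c_gt0 q_neq2; set q := (p ^ c)%N.
have p_dvd_q : (p %| q)%N by rewrite dvdn_exp.
have q_gt0 : (0 < q)%N by rewrite expn_gt0 prime_gt0.
rewrite big_ltn_cond // dvdn0 /= (bigID (fun j => 2 * j < q)%N) /=.
rewrite big_split /=; congr (_ * _).
rewrite big_nat_rev /= big_nat_cond [RHS]big_nat_cond; apply: eq_big => j; last first.
  by case/andP=> /andP[j_gt0 lt_jq] _; congr F; lia.
case: (boolP (1 <= j < q)%N) => //= /andP[j_gt0 lt_jq].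
have -> : (1 + q - j.+1 = q - j)%N by lia.
rewrite dvdn_subr ?(ltnW lt_jq) //; case: (boolP (p %| j)%N) => //= p_ndvd_j.
(* No [j] is its own partner: [2 * j = q] with [j] prime to [p] would make [q] divide 2, so that
   [q = 2]. *)
have q_neq : (2 * j)%N != q.
  apply: contra q_neq2 => /eqP def_q.
  have: (q %| 2 * j)%N by rewrite def_q.
  rewrite Gauss_dvdl; last by rewrite coprimeXl // prime_coprime.
  move=> /(dvdn_leq (isT : 0 < 2)%N).
  have : (p <= q)%N by apply: dvdn_leq.
  by move/prime_gt1: p_pr; rewrite /q => *; apply/eqP; lia.
by move: q_neq => /eqP q_neq; apply/idP/idP; lia.
Qed.

Lemma pfree_block (p c : nat) (y : int) : prime p -> (0 < c)%N ->
  (pfree_prod p ((p ^ c)%N%:Z * y) ((p ^ c)%N)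
   = block_sign ((p ^ c)%N) ^ y * pfree_prod p 0 ((p ^ c)%N)
   %[mod (p ^ c)%N%:Z ^+ 2])%Z.
Proof.
move=> p_pr c_gt0; have [q_eq2 | q_neq2] := eqVneq (p ^ c)%N 2%N.
  have p_eq2 : p = 2%N.
    have: (p %| 2)%N by rewrite -q_eq2 dvdn_exp.
    by rewrite dvdn_prime2 // => /eqP.
  rewrite q_eq2 p_eq2 /pfree_prod /block_sign eqxx.
  rewrite !(big_mkcond (fun j => ~~ _)) /= !big_nat_recr //= !big_geq //=.
  rewrite expN1r.
  apply/eqP; rewrite eqz_mod_dvd; apply/dvdzP.
  (* The block is the single factor [2 * y + 1], congruent to [(-1) ^ y] modulo 4. *)
  have [k [->|->]] : exists k : int, y = 2 * k \/ y = 2 * k + 1.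
  - by exists (y %/ 2)%Z; lia.
  - by exists k; rewrite -signr_odd (_ : odd _ = false) ?expr0; [ring | lia].
  exists (k + 1); rewrite -signr_odd (_ : odd _ = true) ?expr1; first by ring.
  lia.
rewrite /block_sign (negPf q_neq2) exp1rz mul1r /pfree_prod.
rewrite !pfree_prod_fold //; apply: prod_eqz_mod => j /andP[_ lt_2j].
(* The paired products differ by exactly [(p ^ c) ^ 2 * (y ^ 2 + y)]. *)
apply/eqP; rewrite eqz_mod_dvd; apply/dvdzP; exists (y ^+ 2 + y).
have -> : ((p ^ c)%N - j)%N%:Z = (p ^ c)%N%:Z - j%:Z by lia.
by ring.
Qed.

Lemma pfree_prodD (p q m : nat) (x : int) : (p %| m)%N ->
  pfree_prod p x (m + q) = pfree_prod p x m * pfree_prod p (x + m%:Z) q.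
Proof.
move=> p_dvd_m; rewrite /pfree_prod (@big_cat_nat _ _ _ m) ?leq_addr //=.
congr (_ * _); rewrite -{1}[m]add0n big_addn addKn.
apply: eq_big => [j | j _]; first by rewrite dvdn_addl.
by rewrite PoszD; ring.
Qed.

Lemma pfree_blocks (p c t : nat) (y : int) : prime p -> (0 < c)%N ->
  (pfree_prod p ((p ^ c)%N%:Z * y) ((p ^ c)%N * t)
   = block_sign ((p ^ c)%N) ^ (y * t%:Z) * pfree_prod p 0 ((p ^ c)%N * t)
   %[mod (p ^ c)%N%:Z ^+ 2])%Z.
Proof.
move=> p_pr c_gt0; set q := (p ^ c)%N.
have p_dvd_q s : (p %| q * s)%N by rewrite dvdn_mulr ?dvdn_exp.
elim: t => [|t IHt].
  by rewrite mulr0 muln0 expr0z /pfree_prod !big_geq.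
rewrite mulnSr !pfree_prodD // add0r PoszM -mulrDr.
(* The last blocks on the two sides, at offsets [q * (y + t)] and [q * t], both reduce to the block
   at 0; their signs differ by [block_sign q ^ y]. *)
rewrite -modzMm IHt pfree_block // modzMm -/q.
rewrite [in RHS]mulrA -[RHS]modzMmr pfree_block //.
rewrite modzMmr -/q; congr (_ %% _)%Z.
have -> : y * t.+1%:Z = y * t%:Z + y by rewrite -addn1 PoszD; ring.
by rewrite !exprzDr ?block_sign_unit //; ring.
Qed.

(** * Divisibility and signs of the numerators *)

Lemma divn_gcd_dvdz (m : nat) (a c : int) : (0 < m)%N ->
  (m%:Z %| a * c)%Z -> ((m %/ gcdn m `|a|)%N%:Z %| c)%Z.
Proof.
move=> m_gt0; rewrite !dvdzE abszM !absz_nat; set g := gcdn m _ => m_dvd.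
have g_gt0 : (0 < g)%N by rewrite gcdn_gt0 m_gt0.
have co : coprime (m %/ g) (`|a| %/ g).
  rewrite /coprime -(eqn_pmul2r g_gt0) muln_gcdl !divnK ?dvdn_gcdl ?dvdn_gcdr //.
  by rewrite mul1n.
rewrite -(Gauss_dvdr _ co) -(dvdn_pmul2r g_gt0) divnK ?dvdn_gcdl //.
by rewrite mulnAC divnK ?dvdn_gcdr.
Qed.

(** For [l > 0], absorption writes ['C(m, l)] as [m / l] times [binz (m - 1) (l - 1)]. The ratio
    [m / l] is the same for [p * m] and [p * l], so [binz_pred_pfree] applies. *)
Lemma bin_pfree (p m l : nat) : (0 < p)%N ->
  'C(p * m, p * l)%:Z * pfree_prod p 0 (p * l) =
  'C(m, l)%:Z * pfree_prod p (p%:Z * (m%:Z - l%:Z)) (p * l).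
Proof.
move=> p_gt0; case: (posnP l) => [->|l_gt0].
  by rewrite muln0 /pfree_prod !big_geq // !bin0.
have pl_gt0 : (0 < p * l)%N by rewrite muln_gt0 p_gt0.
have l_neq0 : p%:Z * l%:Z != 0 by rewrite mulf_neq0 // eqz_nat -lt0n.
apply: (mulfI l_neq0).
have diag n k : (0 < k)%N ->
    n%:Z * binz (n%:Z - 1) k.-1 = k%:Z * 'C(n, k)%:Z.
  by move=> k_gt0; rewrite mul_binz_diag prednK // binz_nat.
have Epl := diag (p * m)%N _ pl_gt0; have El := diag m _ l_gt0.
have := binz_pred_pfree p l m%:Z p_gt0 l_gt0; rewrite -PoszM => Ep.
transitivity ((p * m)%N%:Z * (binz ((p * m)%N%:Z - 1) (p * l).-1
    * pfree_prod p 0 (p * l))).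
  by rewrite mulrA Epl PoszM; ring.
rewrite Ep PoszM.
transitivity (p%:Z * (m%:Z * binz (m%:Z - 1) l.-1)
    * pfree_prod p (p%:Z * (m%:Z - l%:Z)) (p * l)); first by ring.
by rewrite El; ring.
Qed.

(** For [m > 0] this is [c_ml tau m l] times [m ^ 2]. *)
Definition numer (tau : int) (m l : nat) : int :=
  - (-1) ^ (m%:Z * tau + m%:Z + l%:Z) *
  ('C(m, l)%:Z * binz (m%:Z * tau + l%:Z - 1) m.-1).

(** Each factor contributes one [m / gcd(m, l)]: by absorption, [m] divides [l * 'C(m, l)] and also
    [m * tau + l] times the second factor, and both multipliers have the same gcd with [m]. *)
Lemma bin_mul_binz_dvd (tau : int) (m l : nat) : (0 < m)%N ->
  (((m %/ gcdn m l)%N%:Z) ^+ 2 %|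
   'C(m, l)%:Z * binz (m%:Z * tau + l%:Z - 1) m.-1)%Z.
Proof.
move=> m_gt0; rewrite expr2; apply: dvdz_mul.
  rewrite -[l in gcdn m l]/(`|l%:Z|%N); apply: divn_gcd_dvdz => //.
  case: l => [|l]; first by rewrite mul0r dvdz0.
  by rewrite -binz_nat -mul_binz_diag dvdz_mulr.
have -> : gcdn m l = gcdn m `|m%:Z * tau + l%:Z|.
  have := gcdzMDl tau m%:Z l%:Z; rewrite mulrC /gcdz /= => -[->] //.
apply: divn_gcd_dvdz => //.
by rewrite mul_binz_diag prednK // dvdz_mulr.
Qed.

Lemma sqr_dvd_numer (tau : int) (m l : nat) : (0 < m)%N ->
  (((m %/ gcdn m l)%N%:Z) ^+ 2 %| numer tau m l)%Z.
Proof. by move=> m_gt0; rewrite dvdz_mull // bin_mul_binz_dvd. Qed.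

Lemma signz_shift (a k : int) : (-1 : int) ^ (a + 2 * k) = (-1) ^ a.
Proof. by rewrite exprzDr ?unitrN ?unitr1 // -exprz_exp exp1rz mulr1. Qed.

Lemma mulz_succ_even (a : int) : exists k : int, a * (a + 1) = 2 * k.
Proof.
have [k [->|->]] : exists k : int, a = 2 * k \/ a = 2 * k + 1.
- by exists (a %/ 2)%Z; lia.
- by exists (k * (2 * k + 1)); ring.
- by exists ((2 * k + 1) * (k + 1)); ring.
Qed.

(** The change of sign prefactor cancels the block signs. If [p] is odd, multiplying the exponent by
    [p] keeps its parity; if [p = 2] and [c > 1], then [m] and [l] are even; if [p ^ c = 2], the
    block signs account for the parity. *)
Lemma numer_sign (p c t u m l : nat) (tau : int) : prime p -> (0 < c)%N ->
  (p * m = p ^ c * t)%N -> (p * l = p ^ c * u)%N ->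
  (-1) ^ (m%:Z * tau + m%:Z + l%:Z) =
  (-1) ^ ((p * m)%N%:Z * tau + (p * m)%N%:Z + (p * l)%N%:Z) *
  (block_sign (p ^ c) ^ ((t%:Z - u%:Z) * u%:Z)
   * block_sign (p ^ c) ^ ((t%:Z * tau + u%:Z - t%:Z) * t%:Z)) :> int.
Proof.
move=> p_pr c_gt0 def_m def_l; rewrite -exprzDr ?block_sign_unit //.
have p_gt0 := prime_gt0 p_pr.
rewrite /block_sign; case: eqP => [q_eq2 | q_neq2].
  have p_eq2 : p = 2%N.
    have: (p %| 2)%N by rewrite -q_eq2 dvdn_exp.
    by rewrite dvdn_prime2 // => /eqP.
  have -> : m = t by lia.
  have -> : l = u by lia.
  rewrite p_eq2 !PoszM -mulrA -!mulrDr -exprz_exp exp1rz mul1r.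
  have [hu Eu] := mulz_succ_even u%:Z.
  have [ht Et] := mulz_succ_even (t%:Z - 1).
  have [ht' Et'] := mulz_succ_even t%:Z.
  (* The exponents agree modulo 2 because squares keep parity; the shift is half their
     difference. *)
  rewrite -(signz_shift _ (t%:Z * u%:Z - hu - ht' + ht * tau)); congr (_ ^ _).
  have -> : 2 * (t%:Z * u%:Z - hu - ht' + ht * tau) =
      2 * (t%:Z * u%:Z) - 2 * hu - 2 * ht' + (2 * ht) * tau by ring.
  by rewrite -Eu -Et -Et'; ring.
rewrite exp1rz mulr1 !PoszM.
have -> : p%:Z * m%:Z * tau + p%:Z * m%:Z + p%:Z * l%:Z =
  p%:Z * (m%:Z * tau + m%:Z + l%:Z) by ring.
case: (eqVneq p 2%N) => [p_eq2 | p_neq2]; last first.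
  have p_odd : odd p by case: (even_prime p_pr) p_neq2 => [->|].
  set z := m%:Z * tau + m%:Z + l%:Z.
  have -> : p%:Z = 1 + 2 * (p./2)%:Z by lia.
  by rewrite mulrDl mul1r -mulrA signz_shift.
have c_gt1 : (1 < c)%N by case: c c_gt0 q_neq2 {def_m def_l} => [|[|c]] // _ [].
have E2 n s : (p * n = p ^ c * s)%N -> exists k : int, n%:Z = 2 * k.
  rewrite p_eq2 -(subnKC c_gt1) expnD -mulnA => E.
  by exists (2 ^ (c - 2) * s)%N%:Z; lia.
have [km ->] := E2 _ _ def_m; have [kl ->] := E2 _ _ def_l.
set w := _ + _ + _; have -> : w = 2 * (km * tau + km + kl) by rewrite /w; ring.
by rewrite p_eq2 -!exprz_exp !exp1rz.
Qed.

Lemma coprimez_pfree_prod (p n : nat) : prime p ->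
  coprimez p%:Z (pfree_prod p 0 n).
Proof.
move=> p_pr; rewrite /pfree_prod; apply: (big_ind (coprimez p%:Z)).
- by rewrite coprimezE coprimen1.
- by move=> a b co_a co_b; rewrite coprimezMr co_a.
- by move=> j p_ndvd; rewrite add0r coprimezE !absz_nat prime_coprime.
Qed.

Lemma numer_prime_dvd (tau : int) (p m l : nat) : prime p -> (0 < m)%N ->
  ((p ^ logn p (p * m))%N%:Z ^+ 2 %|
   numer tau (p * m) (p * l) - numer tau m l)%Z.
Proof.
move=> p_pr m_gt0; have p_gt0 := prime_gt0 p_pr.
set g := gcdn m l; have g_gt0 : (0 < g)%N by rewrite gcdn_gt0 m_gt0.
(* [q] is the [p]-part of the gcd of [p * m] and [p * l]; the extra [p] makes [c] positive even when
   [p] does not divide [g]. *)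
set c := logn p (p * g); set q := (p ^ c)%N.
have c_gt0 : (0 < c)%N by rewrite /c lognM // logn_prime // eqxx.
have q_dvd n : (g %| n)%N -> exists t, (p * n = q * t)%N.
  move=> g_dvd; have /dvdnP[t ->] : (q %| p * n)%N.
    by apply: dvdn_trans (pfactor_dvdnn _ _) _; rewrite dvdn_pmul2l.
  by exists t; rewrite mulnC.
have [t def_t] := q_dvd m (dvdn_gcdl _ _).
have [u def_u] := q_dvd l (dvdn_gcdr _ _).
set x := m%:Z * tau + l%:Z.
set P1 := pfree_prod p (p%:Z * (m%:Z - l%:Z)) (p * l).
set P2 := pfree_prod p (p%:Z * (x - m%:Z)) (p * m).
set U1 := pfree_prod p 0 (p * l); set U2 := pfree_prod p 0 (p * m).
(* In [p * m = (m / g) * (p * g)], the second factor has [p]-part [q]. *)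
have pfactorE : (p ^ logn p (p * m) %| (m %/ g) * q)%N.
  have -> : (p * m = (m %/ g) * (p * g))%N.
    by rewrite mulnCA divnK // dvdn_gcdl.
  have mg_gt0 : (0 < m %/ g)%N by rewrite divn_gt0 // dvdn_leq // dvdn_gcdl.
  rewrite lognM ?muln_gt0 ?p_gt0 // expnD.
  by rewrite dvdn_mul // pfactor_dvdnn.
have co : coprimez ((p ^ logn p (p * m))%N%:Z ^+ 2) (U1 * U2).
  rewrite coprimezE abszX !coprimeXl // -[p]/(`|p%:Z|%N) -coprimezE.
  by rewrite coprimezMr !coprimez_pfree_prod.
(* Multiplying by [U1 * U2], which is prime to [p], clears the denominators in the quotient
   formulas. *)
rewrite -(Gauss_dvdzl _ co).
set e1 := (t%:Z - u%:Z) * u%:Z.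
set e2 := (t%:Z * tau + u%:Z - t%:Z) * t%:Z.
have E1 : (P1 = block_sign q ^ e1 * U1 %[mod q%:Z ^+ 2])%Z.
  rewrite /P1 /U1 mulrBr -!PoszM def_t def_u !PoszM -mulrBr.
  by rewrite pfree_blocks.
have E2 : (P2 = block_sign q ^ e2 * U2 %[mod q%:Z ^+ 2])%Z.
  have -> : P2 = pfree_prod p (q%:Z * (t%:Z * tau + u%:Z - t%:Z)) (q * t).
    rewrite /P2 /x -def_t; congr (pfree_prod p _ _).
    rewrite mulrBr mulrDr mulrA -!PoszM def_t def_u !PoszM; ring.
  by rewrite /U2 def_t pfree_blocks.
have E12 : (P1 * P2 = block_sign q ^ e1 * block_sign q ^ e2 * (U1 * U2)
            %[mod q%:Z ^+ 2])%Z.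
  by rewrite -modzMm E1 E2 modzMm; congr (_ %% _)%Z; ring.
set s1 : int := (-1) ^ ((p * m)%N%:Z * tau + (p * m)%N%:Z + (p * l)%N%:Z).
have Es := numer_sign p c t u m l tau p_pr c_gt0 def_t def_u.
rewrite -/s1 -/q -/e1 -/e2 in Es.
set K := 'C(m, l)%:Z * binz (x - 1) m.-1.
have En : numer tau (p * m) (p * l) * (U1 * U2) = - s1 * (K * (P1 * P2)).
  rewrite /numer -/s1.
  have -> : (p * m)%N%:Z * tau + (p * l)%N%:Z = p%:Z * x.
    by rewrite /x !PoszM; ring.
  have EC := bin_pfree p m l p_gt0; have EB := binz_pred_pfree p m x p_gt0 m_gt0.
  rewrite -/U1 -/P1 in EC; rewrite -/U2 -/P2 in EB.
  transitivity (- s1 * (('C(p * m, p * l)%:Z * U1)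
                        * (binz (p%:Z * x - 1) (p * m).-1 * U2))); first by ring.
  by rewrite EC EB /K; ring.
have -> : (numer tau (p * m) (p * l) - numer tau m l) * (U1 * U2) =
    - s1 * (K * (P1 * P2 - block_sign q ^ e1 * block_sign q ^ e2 * (U1 * U2))).
  by rewrite mulrBl En /numer Es -/x -/K; ring.
(* [K] supplies [(m / g) ^ 2] and the congruence [E12] supplies [q ^ 2]. *)
apply/dvdz_mull; apply: (@dvdz_trans ((((m %/ g) * q)%N)%:Z ^+ 2)).
  exact: dvdz_exp2r.
rewrite PoszM exprMn; apply: dvdz_mul; first exact: bin_mul_binz_dvd.
by rewrite -eqz_mod_dvd; apply/eqP.
Qed.

(** * Moebius sums and their divisibility at one prime *)

Lemma mobius_sqr_dvd (p n : nat) : prime p -> (p ^ 2 %| n)%N -> mobius n = 0.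
Proof.
move=> p_pr p2_dvd; rewrite /mobius; case: posnP => //= n_gt0.
case: ifP => // /allP /(_ p); rewrite mem_primes p_pr n_gt0 /=.
rewrite pfactor_dvdn // in p2_dvd.
rewrite (dvdn_trans _ (pfactor_dvdnn p n)) ?dvdn_exp ?(ltnW p2_dvd) //.
by move/(_ isT); rewrite leqNgt p2_dvd.
Qed.

Lemma mobius_primeM (p n : nat) : prime p -> ~~ (p %| n)%N ->
  mobius (p * n) = - mobius n.
Proof.
move=> p_pr p_ndvd; have p_gt0 := prime_gt0 p_pr.
have n_gt0 : (0 < n)%N by case: n p_ndvd; rewrite ?dvdn0.
have primes_pn : perm_eq (primes (p * n)) (p :: primes n).
  apply: uniq_perm; rewrite ?primes_uniq //=.
    by rewrite mem_primes (negPf p_ndvd) !andbF primes_uniq.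
  by move=> r; rewrite primesM // primes_prime // !inE.
rewrite /mobius muln_eq0 !eqn0Ngt p_gt0 n_gt0 /= (perm_size primes_pn) exprS.
rewrite (perm_all _ primes_pn) /= lognM // logn_prime // eqxx.
have /eqP -> : logn p n == 0%N by rewrite logn_coprime // prime_coprime.
rewrite (@eq_in_all _ _ (fun r => logn r n <= 1)%N).
  by case: all; rewrite ?oppr0 ?mulN1r.
move=> r; rewrite mem_primes => /and3P[r_pr _ r_dvd].
rewrite lognM // logn_prime //; case: eqP => // r_eq.
by rewrite -r_eq r_dvd in p_ndvd.
Qed.

(** Terms with [p ^ 2] dividing [d] vanish. The other multiples of [p] are the [p * e] with [e]
    prime to [p]; these divide [g] exactly when [e] does, and carry the opposite sign. *)
Lemma mobius_sum_prime (p g : nat) (F : nat -> int) :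
  prime p -> (0 < g)%N -> (p %| g)%N ->
  \sum_(d <- divisors g) mobius d * F d =
  \sum_(d <- divisors g | ~~ (p %| d)%N) mobius d * (F d - F (p * d)%N).
Proof.
move=> p_pr g_gt0 p_dvd; have p_gt0 := prime_gt0 p_pr.
have Edvd d : ~~ (p %| d)%N -> (p * d %| g)%N = (d %| g)%N.
  by move=> p_ndvd; rewrite Gauss_dvd ?prime_coprime // p_dvd.
rewrite (bigID (fun d => p %| d)%N) /= addrC.
under [RHS]eq_bigr do rewrite mulrBr.
rewrite big_split /=; congr (_ + _).
rewrite (bigID (fun d => p ^ 2 %| d)%N) /= big1 ?add0r => [|d /andP[_ p2_dvd]];
  last by rewrite (mobius_sqr_dvd p) ?mul0r.
rewrite -big_filter -[RHS]big_filter.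
rewrite (perm_big [seq (p * d)%N | d <- divisors g & ~~ (p %| d)%N]) /=.
  rewrite big_map !big_filter; apply: eq_bigr => d p_ndvd.
  by rewrite mobius_primeM // mulNr.
apply: uniq_perm; first by rewrite filter_uniq ?divisors_uniq.
  rewrite map_inj_uniq ?filter_uniq ?divisors_uniq // => a b /eqP.
  by rewrite eqn_pmul2l // => /eqP.
move=> d; rewrite mem_filter -dvdn_divisors //; apply/idP/mapP.
  case/andP=> /andP[/dvdnP[e ->]]; rewrite (mulnC e) expnS expn1 dvdn_pmul2l //.
  move=> p_ndvd pe_dvd; exists e => //.
  by rewrite mem_filter p_ndvd -dvdn_divisors // -Edvd.
case=> e; rewrite mem_filter -dvdn_divisors // => /andP[p_ndvd e_dvd] ->.
by rewrite dvdn_mulr //= expnS expn1 dvdn_pmul2l // p_ndvd Edvd.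
Qed.

Definition numer_sum (tau : int) (m l : nat) : int :=
  \sum_(d <- divisors (gcdn m l)) mobius d * numer tau (m %/ d) (l %/ d).

Lemma numer_sum_pfactor_dvd (tau : int) (p m l : nat) :
  prime p -> (0 < m)%N ->
  ((p ^ logn p m)%N%:Z ^+ 2 %| numer_sum tau m l)%Z.
Proof.
move=> p_pr m_gt0; rewrite /numer_sum; set g := gcdn m l.
have p_gt0 := prime_gt0 p_pr.
have g_gt0 : (0 < g)%N by rewrite gcdn_gt0 m_gt0.
have dvd_ml d : (d \in divisors g) -> [/\ (0 < d)%N, (d %| m)%N & (d %| l)%N].
  rewrite -dvdn_divisors // => d_dvd; have := d_dvd.
  by rewrite dvdn_gcd => /andP[-> ->]; rewrite (dvdn_gt0 g_gt0 d_dvd).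
have dvdz_sum (D : int) (P : pred nat) (F : nat -> int) :
    (forall d, d \in divisors g -> P d -> (D %| F d)%Z) ->
    (D %| \sum_(d <- divisors g | P d) F d)%Z.
  move=> dvdF; rewrite big_seq_cond; apply: (big_ind (fun x => (D %| x)%Z)).
  - exact: dvdz0.
  - by move=> a b; apply: rpredD.
  - by move=> d /andP[]; apply: dvdF.
case: (boolP (p %| g)%N) => [p_dvd | p_ndvd]; last first.
  (* Each term is divisible by itself: dividing [m] and [l] by [d] preserves [m / g], whose [p]-part
     is that of [m]. *)
  apply: dvdz_sum => d /dvd_ml[d_gt0 d_dvd_m d_dvd_l] _; apply: dvdz_mull.
  have md_gt0 : (0 < m %/ d)%N by rewrite divn_gt0 // dvdn_leq.
  apply: (dvdz_trans _ (sqr_dvd_numer tau _ (l %/ d) md_gt0)).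
  apply: dvdz_exp2r; rewrite dvdzE !absz_nat.
  have -> : gcdn (m %/ d) (l %/ d) = (g %/ d)%N.
    apply/eqP; rewrite -(eqn_pmul2r d_gt0) muln_gcdl !divnK //.
    by rewrite dvdn_gcd d_dvd_m.
  have -> : (m %/ d %/ (g %/ d) = m %/ g)%N.
    rewrite -{2}[g](@divnK d) ?dvdn_gcd ?d_dvd_m // mulnC divnMA //.
  have -> : logn p m = logn p (m %/ g).
    rewrite logn_div ?dvdn_gcdl // -[LHS]subn0; congr (_ - _)%N.
    by apply/esym/eqP; rewrite logn_coprime // prime_coprime.
  exact: pfactor_dvdnn.
rewrite (mobius_sum_prime p) //; apply: dvdz_sum => d d_in p_ndvd.
have [d_gt0 d_dvd_m d_dvd_l] := dvd_ml d d_in.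
have pd_dvd : (p * d %| g)%N.
  by rewrite Gauss_dvd ?prime_coprime // p_dvd dvdn_divisors.
have [pd_dvd_m pd_dvd_l] : (p * d %| m)%N /\ (p * d %| l)%N.
  by apply/andP; rewrite -dvdn_gcd.
have E n : (p * d %| n)%N -> (n %/ d = p * (n %/ (p * d)))%N.
  by case/dvdnP=> k ->; rewrite mulnK ?muln_gt0 ?p_gt0 // mulnA mulnK // mulnC.
apply: dvdz_mull; rewrite (E m) // (E l) //.
(* Since [p] does not divide [d], passing from [m] to [m / d] preserves the [p]-part. *)
have -> : logn p m = logn p (p * (m %/ (p * d))).
  rewrite -E // logn_div //; have /eqP -> : logn p d == 0%N.
    by rewrite logn_coprime // prime_coprime.
  by rewrite subn0.
by apply: numer_prime_dvd; rewrite // divn_gt0 ?muln_gt0 ?p_gt0 // dvdn_leq.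
Qed.

(** * Assembling the primes and integrality *)

Lemma sqr_dvd_numer_sum (tau : int) (m l : nat) : (0 < m)%N ->
  (m%:Z ^+ 2 %| numer_sum tau m l)%Z.
Proof.
move=> m_gt0; rewrite dvdzE abszX absz_nat; apply/dvdn_partP.
  by rewrite expn_gt0 m_gt0.
move=> p; rewrite pi_of_exp // mem_primes => /andP[p_pr _].
rewrite p_part lognX mulnC expnM.
by have := numer_sum_pfactor_dvd tau p m l p_pr m_gt0; rewrite dvdzE abszX.
Qed.

(** The denominators [d ^ 2] and [(m / d) ^ 2] multiply to [m ^ 2] in every term. *)
Lemma n_mlE (tau : int) (m l : nat) : (0 < m)%N ->
  n_ml tau m l = (numer_sum tau m l)%:~R / (m%:Z ^+ 2)%:~R.
Proof.
move=> m_gt0; have g_gt0 : (0 < gcdn m l)%N by rewrite gcdn_gt0 m_gt0.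
rewrite /n_ml -big_filter (perm_big (divisors (gcdn m l))) /=; last first.
  apply: uniq_perm; rewrite ?filter_uniq ?divisors_uniq // => d.
  by rewrite mem_filter -!dvdn_divisors // dvdn_gcd andbC.
rewrite /numer_sum rmorph_sum mulr_suml /= big_seq [RHS]big_seq.
apply: eq_bigr => d; rewrite -dvdn_divisors // => d_dvd_g.
have d_gt0 := dvdn_gt0 g_gt0 d_dvd_g.
have d_dvd : (d %| m)%N by apply: dvdn_trans d_dvd_g (dvdn_gcdl _ _).
have md_gt0 : (0 < m %/ d)%N by rewrite divn_gt0 // dvdn_leq.
rewrite /c_ml /numer; set k := (m %/ d)%N; set j := (l %/ d)%N.
have -> : (m%:Z ^+ 2)%:~R = (k%:R * d%:R) ^+ 2 :> rat.
  by rewrite rmorphXn /= -natrM divnK.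
rewrite !rmorphM rmorphN /= rmorphXz ?unitrN ?unitr1 // rmorphN1.
have k_neq0 : k%:R != 0 :> rat by rewrite pnatr_eq0 -lt0n.
have d_neq0 : d%:R != 0 :> rat by rewrite pnatr_eq0 -lt0n.
rewrite -pmulrn; set s := (-1) ^ _.
by field; rewrite k_neq0 d_neq0.
Qed.

Theorem theorem1p1 (tau : int) (m l : nat) :
  (1 <= m)%N -> n_ml tau m l \is a Num.int.
Proof.
by move=> m_gt0; rewrite n_mlE // Qint_dvdz // sqr_dvd_numer_sum.
Qed.
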